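(* Let $q>n/(n+2)$ with $q\ne 1$, and let $C$ be a positive definite symmetric $n\times n$ matrix. For a fixed $\mu$, write $f_\tau$ ($\tau>0$) for the density of an $\mathbf{R}_{q,\tau^\mu C}$ random variable. If $\mu=\dfrac{2}{2+n(q-1)}$, then $f_\tau$ satisfies a heat equation of the form $$K_q\,\frac{\partial}{\partial\tau}f_\tau(\mathbf{x})=\sum_{k,l} C_{kl}\,\frac{\partial^2}{\partial x_k\,\partial x_l}\,f_\tau^{q}(\mathbf{x}),$$ with $$K_q=A_q^{\,q-1}\,\frac{2q\,(2+n(q-1))}{2q+n(q-1)},$$ where $A_q$ is the normalization constant of $g_{q,C}$ (computed with the matrix $C$).
   Context: For $q>n/(n+2)$, $q\neq1$, and a positive definite symmetric $n\times n$ matrix $C$, define the probability density on $\mathbb{R}^n$ $$g_{q,C}(\mathbf{x})=A_q\left(1-(q-1)\beta\,\mathbf{x}^TC^{-1}\mathbf{x}\right)_+^{\frac{1}{q-1}},\qquad \beta=\frac{1}{2q-n(1-q)},$$ where $x_+=\max(x,0)$ and the normalization constant (which depends on $q$, $n$ and $C$) is $$A_q=\begin{cases}\dfrac{\Gamma\left(\frac{1}{1-q}\right)(\beta(1-q))^{n/2}}{\Gamma\left(\frac1{1-q}-\frac n2\right)\pi^{n/2}|C|^{1/2}} & \text{if } \frac{n}{n+2}<q<1,\\[3mm] \dfrac{\Gamma\left(\frac{q}{q-1}+\frac n2\right)(\beta(q-1))^{n/2}}{\Gamma\left(\frac{q}{q-1}\right)\pi^{n/2}|C|^{1/2}} & \text{if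 } q>1,\end{cases}$$ with $|C|$ the determinant of $C$. $\mathbf{R}_{q,C}$ denotes a random vector with density $g_{q,C}$; it has mean $\mathbf{0}$ and covariance $C$. Thus $f_\tau=g_{q,\tau^\mu C}$, and $f_\tau^q(\mathbf{x})$ means $(f_\tau(\mathbf{x}))^q$.
   Formalization: For q ≥ 2 the equation is claimed only at x off the boundary of the support of f_τ, i.e. where 1-(q-1)β x^T(τ^μ C)^{-1}x ≠ 0, since on that boundary f_τ is not differentiable in τ. *)

(* Defs.v *)
From HB Require Import structures.
From mathcomp Require Import all_boot all_order all_algebra.
From mathcomp Require Import all_classical all_reals all_analysis.
Set Implicit Arguments.
Unset Strict Implicit.
Unset Printing Implicit Defensive.
Import Order.TTheory GRing.Theory Num.Theory.
Import numFieldNormedType.Exports.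
Local Open Scope classical_set_scope.
Local Open Scope ring_scope.

(* Euler's integral; only meaningful for 0 < s, which is where it is used. *)
Definition Gamma (R : realType) (s : R) : R :=
  (\int[@lebesgue_measure R]_(t in `]0%R, +oo[) (t `^ (s - 1) * expR (- t)))%R.

Definition posdef (R : realType) (n : nat) (C : 'M[R]_n) : Prop :=
  forall x : 'cV[R]_n, x != 0 -> 0 < (x^T *m C *m x) 0 0.

Definition qbeta (R : realType) (n : nat) (q : R) : R :=
  (2 * q - n%:R * (1 - q))^-1.

(* The case q = 1 is excluded by every use; it falls in the last branch. *)
Definition qnorm (R : realType) (n : nat) (q : R) (C : 'M[R]_n) : R :=
  if q < 1 then
    Gamma (1 / (1 - q)) * (qbeta n q * (1 - q)) `^ (n%:R / 2) /
    (Gamma (1 / (1 - q) - n%:R / 2) * pi `^ (n%:R / 2) * Num.sqrt (\det C))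
  else
    Gamma (q / (q - 1) + n%:R / 2) * (qbeta n q * (q - 1)) `^ (n%:R / 2) /
    (Gamma (q / (q - 1)) * pi `^ (n%:R / 2) * Num.sqrt (\det C)).

(* The expression whose positive part is raised to the power 1 / (q - 1). *)
Definition qbase (R : realType) (n : nat) (q : R) (C : 'M[R]_n)
    (x : 'cV[R]_n) : R :=
  1 - (q - 1) * qbeta n q * (x^T *m invmx C *m x) 0 0.

Definition qdensity (R : realType) (n : nat) (q : R) (C : 'M[R]_n)
    (x : 'cV[R]_n) : R :=
  qnorm q C * Num.max (qbase q C x) 0 `^ (1 / (q - 1)).

Definition partial (R : realType) (n : nat) (k : 'I_n) (f : 'cV[R]_n -> R)
    (x : 'cV[R]_n) : R :=
  'D_(delta_mx k 0) f x.

(* [derive] is total, so existence of d^2 f / dx_k dx_l at x has to be stated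
   separately: d f / dx_l exists around x and has a k-th partial at x. *)
Definition ex_partial2 (R : realType) (n : nat) (k l : 'I_n)
    (f : 'cV[R]_n -> R) (x : 'cV[R]_n) : Prop :=
  (\forall y \near x, derivable f y (delta_mx l 0)) /\
  derivable (partial l f) x (delta_mx k 0).

(* Main.v *)
(* With p = 1/(q-1), M = C^-1, s = x^T M x, c = (q-1) beta tau^-mu and
   b = 1 - c s, one has f = A tau^(-mu n/2) b_+^p and
   f^q = A^q tau^(-q mu n/2) b_+^(p+1). Contracting the Hessian of b_+^(p+1)
   with C gives 4 (p+1) c (p s c b_+^(p-1) - n/2 b_+^p), and the tau-derivative
   of f is proportional to the same bracket. The factors agree because the
   choice of mu makes the exponents of tau equal. Only A >= 0 is needed, since
   for A = 0 both sides would vanish. *)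
Require Import Defs.
From HB Require Import structures.
From mathcomp Require Import all_boot all_order all_algebra.
From mathcomp Require Import all_classical all_reals all_analysis.
From mathcomp Require Import ring lra.
Import Order.TTheory GRing.Theory Num.Theory.
Import numFieldNormedType.Exports.
Local Open Scope classical_set_scope.
Local Open Scope ring_scope.
Set Implicit Arguments.
Unset Strict Implicit.

(** * Truncated powers *)

(* Agrees with [Num.max b 0 `^ r] except at [r = 0], where [0 `^ 0 = 1]. This
   matters for the second derivative when [1 / (q - 1) = 1]. *)
Definition pospow (R : realType) (r b : R) : R := if 0 < b then b `^ r else 0.

Lemma powR_max0 (R : realType) (r b : R) :
  r != 0 -> Num.max b 0 `^ r = pospow r b.
Proof.
move=> r0; rewrite /pospow; case: ltP => // _.
by rewrite powR0.
Qed.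

Lemma pospow_powR (R : realType) (r s b : R) :
  s != 0 -> pospow r b `^ s = pospow (r * s) b.
Proof.
by move=> s0; rewrite /pospow; case: ifP => _; rewrite ?powRrM// powR0.
Qed.

Lemma pospow_ge0 (R : realType) (r b : R) : 0 <= pospow r b.
Proof. by rewrite /pospow; case: ifP => // _; exact: powR_ge0. Qed.

Lemma mul_pospow (R : realType) (r b : R) :
  b * pospow (r - 1) b = pospow r b.
Proof.
rewrite /pospow; case: ifP => b0; last by rewrite mulr0.
rewrite -{1}(powRr1 (ltW b0)) -powRD ?subrKC//.
by rewrite (gt_eqF b0) implybT.
Qed.

(** Off [0] the function is locally zero or locally a power. At [0] the left difference quotients
    vanish and the right ones are [h ^ (r - 1)], which tends to [0] because [1 < r]. *)
Lemma is_derive_pospow (R : realType) (r b : R) : b != 0 \/ 1 < r ->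
  is_derive b 1 (pospow r) (r * pospow (r - 1) b).
Proof.
case: (ltgtP b 0) => [b0 _|b0 _|->].
- rewrite {2}/pospow ltNge ltW// mulr0.
  apply: (@near_eq_is_derive _ _ _ (cst 0)).
  near=> y; rewrite /pospow ltNge ltW//.
  by near: y; apply: lt_nbhsl.
- rewrite {2}/pospow b0.
  apply: (@near_eq_is_derive _ _ _ ((@powR R)^~ r)); last first.
    exact: is_derive1_powR.
  near=> y; rewrite /pospow ifT//.
  by near: y; apply: lt_nbhsr.
- case=> // r1.
  have lim0 : (h^-1 *: (pospow r (h *: 1 + 0) - pospow r 0)) @[h --> 0^']
      --> (0 : R).
    apply: (@cvg_at_right_left_dnbhs _ R^o).
      apply: (cvg_trans _ (@powR_cvg0 R (r - 1) _)); last by rewrite subr_gt0.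
      apply: near_eq_cvg; near=> h.
      have h0 : 0 < h by [].
      rewrite {2}/pospow ltxx subr0 addr0 [h *: 1]mulr1 -mul_pospow.
      by rewrite /GRing.scale/= mulKf ?gt_eqF// /pospow h0.
    apply: (cvg_trans _ (@cvg_cst R _ _ 0^'- _)).
    apply: near_eq_cvg; near=> h.
    have h0 : h < 0 by [].
    by rewrite /pospow ltxx subr0 addr0 [h *: 1]mulr1 ltNge ltW// scaler0.
  rewrite [X in r * X]/pospow ltxx mulr0; apply: DeriveDef.
    by apply/cvg_ex; exists 0.
  exact: (cvg_lim (@Rhausdorff R) lim0).
Unshelve. all: by end_near. Qed.

(** * Directional derivatives of quadratic forms *)

(** The two difference quotients are the same function of [h], so directional derivatives reduce to
    one real variable. *)
Lemma is_derive_line (R : realType) (V : normedModType R) (f : V -> R)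
    (x v : V) (d : R) :
  is_derive (0 : R) 1 (fun t => f (t *: v + x)) d <-> is_derive x v f d.
Proof.
set g := fun t : R => f (t *: v + x).
have E : (fun h : R => h^-1 *: ((g \o shift 0) (h *: 1) - g 0))
    = (fun h => h^-1 *: ((f \o shift x) (h *: v) - f x)).
  by apply/funext => h; rewrite /g /= addr0 scale0r add0r [h *: 1]mulr1.
have Ecvg : derivable g (0 : R) 1 = derivable f x v.
  exact: (congr1 (fun F : R -> R => cvg (F @ 0^')) E).
have Elim : 'D_1 g (0 : R) = 'D_v f x.
  exact: (congr1 (fun F : R -> R => lim (F @ 0^')) E).
split=> -[cvgd limd]; apply: DeriveDef.
- by rewrite -Ecvg.
- by rewrite -Elim.
- by rewrite Ecvg.
- by rewrite Elim.
Qed.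

Lemma is_derive_comp (R : realType) (V : normedModType R) (g : R -> R)
    (f : V -> R) (x v : V) (dg df : R) :
  is_derive (f x) 1 g dg -> is_derive x v f df ->
  is_derive x v (g \o f) (dg * df).
Proof.
move=> gdg /is_derive_line fdf; apply/is_derive_line.
apply: (@is_derive1_comp _ g (fun t => f (t *: v + x))) => //.
by rewrite scale0r add0r.
Qed.

Lemma is_derive_mulmx (R : realType) (n : nat) (M : 'M[R]_n)
    (x v : 'cV[R]_n) (l : 'I_n) :
  is_derive x v (fun y => (M *m y) l 0) ((M *m v) l 0).
Proof.
apply/is_derive_line.
have -> : (fun t => (M *m (t *: v + x)) l 0)
    = (fun t : R => t * (M *m v) l 0 + (M *m x) l 0).
  by apply/funext => t; rewrite mulmxDr -scalemxAr !mxE.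
apply: is_derive_eq.
by rewrite /GRing.scale/=; ring.
Qed.

(** On the line [t v + x] the form is a quadratic polynomial in [t], whose linear coefficient is the
    derivative at [t = 0]. *)
Lemma is_derive_quadform (R : realType) (n : nat) (M : 'M[R]_n)
    (x v : 'cV[R]_n) :
  is_derive x v (fun y => (y^T *m M *m y) 0 0)
    ((v^T *m M *m x) 0 0 + (x^T *m M *m v) 0 0).
Proof.
apply/is_derive_line.
have -> : (fun t => ((t *: v + x)^T *m M *m (t *: v + x)) 0 0)
    = (fun t : R => t * t * (v^T *m M *m v) 0 0
        + t * ((v^T *m M *m x) 0 0 + (x^T *m M *m v) 0 0)
        + (x^T *m M *m x) 0 0).
  apply/funext => t.
  have -> : (t *: v + x)^T = t *: v^T + x^T.
    by apply/matrixP => i j; rewrite !mxE.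
  rewrite !(mulmxDl, mulmxDr) -!scalemxAl -!scalemxAr.
  rewrite !mxE; ring.
apply: is_derive_eq.
by rewrite /GRing.scale/=; ring.
Qed.

Lemma quadform_delta (R : comPzRingType) (n : nat) (M : 'M[R]_n)
    (x : 'cV[R]_n) (l : 'I_n) : M^T = M ->
  ((delta_mx l 0 : 'cV_n)^T *m M *m x) 0 0
  + (x^T *m M *m (delta_mx l 0 : 'cV_n)) 0 0
  = 2 * (M *m x) l 0.
Proof.
move=> M_sym; rewrite -colE trmx_delta -mulmxA -rowE.
rewrite -[in X in _ + X]M_sym -trmx_mul mxE.
rewrite [in X in _ + X]mxE [in X in _ + X]mxE.
by rewrite -mulr2n mulr_natl.
Qed.

Lemma is_derive_quadform_delta (R : realType) (n : nat) (M : 'M[R]_n)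
    (x : 'cV[R]_n) (l : 'I_n) : M^T = M ->
  is_derive x (delta_mx l 0) (fun y => (y^T *m M *m y) 0 0)
    (2 * (M *m x) l 0).
Proof.
move=> M_sym; apply: is_derive_eq (is_derive_quadform M x _) _.
exact: quadform_delta.
Qed.

(** Serves twice: [r = p + 1] for the gradient of [f^q], then [r = p] for its Hessian. *)
Lemma is_derive_pospow_quadform (R : realType) (n : nat) (M : 'M[R]_n)
    (r c : R) (x : 'cV[R]_n) (l : 'I_n) : M^T = M ->
  1 - c * (x^T *m M *m x) 0 0 != 0 \/ 1 < r ->
  is_derive x (delta_mx l 0)
    (fun y => pospow r (1 - c * (y^T *m M *m y) 0 0))
    (r * pospow (r - 1) (1 - c * (x^T *m M *m x) 0 0)
       * (- (2 * c) * (M *m x) l 0)).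
Proof.
move=> M_sym x_ok.
apply: (is_derive_comp (g := pospow r)
  (f := fun y => 1 - c * (y^T *m M *m y) 0 0)).
  exact: is_derive_pospow.
have D := is_derive_quadform_delta x l M_sym.
apply: is_derive_eq.
by rewrite /GRing.scale/=; ring.
Qed.

(** * Linear algebra of a positive definite matrix *)

(** A nonzero row [v] with [v C = 0] would make the quadratic form vanish at [v^T]. *)
Lemma posdef_unitmx (R : realType) (n : nat) (C : 'M[R]_n) :
  posdef C -> C \in unitmx.
Proof.
move=> C_pos; rewrite -row_free_unit -kermx_eq0.
apply/negPn/negP => /rowV0Pn[v /sub_kermxP vC v0].
have := C_pos v^T; rewrite trmxK vC mul0mx mxE ltxx trmx_eq0 => /(_ v0).
by [].
Qed.

Lemma quadform_invmx (R : realType) (n : nat) (C : 'M[R]_n) (x : 'cV[R]_n) :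
  C \in unitmx -> C^T = C ->
  x^T *m invmx C *m x = (invmx C *m x)^T *m C *m (invmx C *m x).
Proof.
move=> C_unit C_sym.
by rewrite trmx_mul trmx_inv C_sym -!mulmxA mulKVmx.
Qed.

Lemma quadform_invmx_ge0 (R : realType) (n : nat) (C : 'M[R]_n)
    (x : 'cV[R]_n) :
  posdef C -> C^T = C -> 0 <= (x^T *m invmx C *m x) 0 0.
Proof.
move=> C_pos C_sym; rewrite quadform_invmx ?posdef_unitmx//.
have [->|] := eqVneq (invmx C *m x) 0; first by rewrite mulmx0 mxE.
by move=> /C_pos/ltW.
Qed.

(** Contracts with [C] a Hessian made of a rank-one part and a multiple of [C^-1]. With [u = C^-1 x]
    the first part gives [u^T C u = x^T C^-1 x], the second the trace of [C C^-1], which is [n]. *)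
Lemma sum_mul_rank1_invmx (R : realType) (n : nat) (C : 'M[R]_n)
    (x : 'cV[R]_n) (a b : R) : C \in unitmx -> C^T = C ->
  \sum_(k < n) \sum_(l < n)
    C k l * (a * (invmx C *m x) k 0 * (invmx C *m x) l 0 + b * invmx C l k)
  = a * (x^T *m invmx C *m x) 0 0 + b * n%:R.
Proof.
move=> C_unit C_sym; rewrite quadform_invmx//.
set u := invmx C *m x.
have -> : (u^T *m C *m u) 0 0
    = \sum_(k < n) \sum_(l < n) C k l * (u k 0 * u l 0).
  rewrite -mulmxA mxE; apply: eq_bigr => k _.
  rewrite !mxE mulr_sumr; apply: eq_bigr => l _; ring.
have -> : n%:R = \sum_(k < n) \sum_(l < n) C k l * invmx C l k :> R.
  rewrite -(mxtrace1 R n) -(mulmxV C_unit); apply: eq_bigr => k _.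
  by rewrite mxE.
rewrite !mulr_sumr -big_split; apply: eq_bigr => k _ /=.
rewrite !mulr_sumr -big_split; apply: eq_bigr => l _ /=.
ring.
Qed.

(** * Dependence of the density on [tau] *)

Lemma Gamma_ge0 (R : realType) (s : R) : 0 <= Gamma s.
Proof.
by apply: Rintegral_ge0 => t _; rewrite mulr_ge0 ?powR_ge0 ?expR_ge0.
Qed.

Lemma qnorm_ge0 (R : realType) (n : nat) (q : R) (C : 'M[R]_n) :
  0 <= qnorm q C.
Proof.
by rewrite /qnorm; case: ifP => _;
  rewrite divr_ge0 ?mulr_ge0 ?Gamma_ge0 ?powR_ge0 ?sqrtr_ge0.
Qed.

(** Only the determinant sees the scaling: [det (a C) = a^n det C], and its square root sits in the
    denominator. *)
Lemma qnormZ (R : realType) (n : nat) (q a : R) (C : 'M[R]_n) : 0 < a ->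
  qnorm q (a *: C) = qnorm q C * a `^ (- (n%:R / 2)).
Proof.
move=> a0; have a0' := ltW a0.
have E : Num.sqrt (\det (a *: C)) = Num.sqrt (\det C) * a `^ (n%:R / 2).
  by rewrite detZ sqrtrM ?exprn_ge0// -powR_mulrn// -powR12_sqrt ?powR_ge0//
     -powRrM mulrC.
by rewrite /qnorm E powRN; case: ifP => _; rewrite mulrA [in LHS]invfM !mulrA.
Qed.

Lemma qbaseZ (R : realType) (n : nat) (q a : R) (C : 'M[R]_n) (x : 'cV[R]_n) :
  a != 0 -> C \in unitmx ->
  qbase q (a *: C) x
  = 1 - (q - 1) * qbeta n q * a^-1 * (x^T *m invmx C *m x) 0 0.
Proof.
move=> a0 C_unit; rewrite /qbase invmxZ ?unitmxZ ?unitfE//.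
by rewrite -scalemxAr -scalemxAl mxE !mulrA.
Qed.

Lemma qdensityE (R : realType) (n : nat) (q mu tau : R) (C : 'M[R]_n)
    (x : 'cV[R]_n) : 0 < tau -> q != 1 -> C \in unitmx ->
  qdensity q (tau `^ mu *: C) x
  = qnorm q C * tau `^ (- (mu * (n%:R / 2))) * pospow (q - 1)^-1
      (1 - (q - 1) * qbeta n q * tau `^ (- mu) * (x^T *m invmx C *m x) 0 0).
Proof.
move=> tau0 q1 C_unit; have tau_mu0 := powR_gt0 mu tau0.
rewrite /qdensity powR_max0 ?div1r ?invr_eq0 ?subr_eq0//.
by rewrite qnormZ// qbaseZ ?gt_eqF// -powRrM mulrN (powRN _ mu).
Qed.

Lemma qdensity_powR (R : realType) (n : nat) (q mu tau : R) (C : 'M[R]_n)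
    (x : 'cV[R]_n) : 0 < tau -> q != 0 -> q != 1 -> C \in unitmx ->
  qdensity q (tau `^ mu *: C) x `^ q
  = qnorm q C `^ q * tau `^ (- (mu * (n%:R / 2)) * q) *
    pospow ((q - 1)^-1 + 1)
      (1 - (q - 1) * qbeta n q * tau `^ (- mu) * (x^T *m invmx C *m x) 0 0).
Proof.
move=> tau0 q0 q1 C_unit; rewrite qdensityE//.
rewrite !powRM ?mulr_ge0 ?qnorm_ge0 ?powR_ge0 ?pospow_ge0//.
rewrite pospow_powR// -powRrM; congr (_ * pospow _ _).
(* The new exponent is [q / (q - 1) = 1 / (q - 1) + 1]. *)
by field; rewrite subr_eq0.
Qed.

(** Product rule for [t ^ (- a)] times the truncated power; both terms carry a factor [1 / tau],
    which is pulled out. *)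
Lemma is_derive_qdensity_tau (R : realType) (n : nat) (q mu tau : R)
    (C : 'M[R]_n) (x : 'cV[R]_n) : 0 < tau -> q != 1 -> C \in unitmx ->
  let a := mu * (n%:R / 2) in let p := (q - 1)^-1 in
  let c := (q - 1) * qbeta n q * tau `^ (- mu) in
  let s := (x^T *m invmx C *m x) 0 0 in
  1 - c * s != 0 \/ 1 < p ->
  is_derive tau 1 (fun t => qdensity q (t `^ mu *: C) x)
    (qnorm q C * tau `^ (- a) / tau *
     (p * pospow (p - 1) (1 - c * s) * (mu * c * s)
      - a * pospow p (1 - c * s))).
Proof.
move=> tau0 q1 C_unit a p c s x_ok.
pose b (t : R) := 1 - (q - 1) * qbeta n q * t `^ (- mu) * s.
apply: (@near_eq_is_derive _ _ _
  (fun t : R => qnorm q C * t `^ (- a) * pospow p (b t))).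
  near=> t; rewrite qdensityE//.
  by near: t; apply: lt_nbhsr.
have powRB1 (r : R) : tau `^ (r - 1) = tau `^ r / tau.
  by rewrite powRD ?(gt_eqF tau0) ?implybT// powR_inv1// ltW.
have Dpow (r : R) := is_derive1_powR r tau0.
have Db : is_derive tau 1 b (mu * c * s / tau).
  have Dmu := Dpow (- mu).
  apply: is_derive_eq.
  rewrite powRB1 /c /GRing.scale /=; ring.
have Dp : is_derive tau 1 (pospow p \o b)
    (p * pospow (p - 1) (b tau) * (mu * c * s / tau)).
  apply: is_derive_comp => //; exact: is_derive_pospow.
have Da := Dpow (- a).
have DA : is_derive tau 1 (fun t : R => qnorm q C * t `^ (- a))
    (qnorm q C * (- a * tau `^ (- a - 1))).
  apply: is_derive_eq; rewrite /GRing.scale /=; ring.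
apply: is_derive_eq (is_deriveM DA Dp) _.
rewrite powRB1 /GRing.scale /= /b -/c; ring.
Unshelve. all: by end_near. Qed.

Unset Implicit Arguments.
Set Strict Implicit.

(* For q > 1 the density has compact support, and for q >= 2 it has no
   tau-derivative on the boundary of its support (where qbase vanishes): those
   points, and only those, are excluded. *)
Theorem theorem3p1 (R : realType) (n : nat) (q mu : R) (C : 'M[R]_n)
    (q_gt : n%:R / (n%:R + 2) < q) (q_neq1 : q != 1)
    (C_sym : C^T = C) (C_posdef : posdef C)
    (mu_def : mu = 2 / (2 + n%:R * (q - 1))) :
  let f (tau : R) (x : 'cV[R]_n) := qdensity q (tau `^ mu *: C) x in
  let fq (tau : R) (x : 'cV[R]_n) := f tau x `^ q in
  let K := qnorm q C `^ (q - 1) *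
           (2 * q * (2 + n%:R * (q - 1)) / (2 * q + n%:R * (q - 1))) in
  forall (tau : R) (x : 'cV[R]_n), 0 < tau ->
    (q < 2 \/ qbase q (tau `^ mu *: C) x != 0) ->
    [/\ derivable (f^~ x) tau 1,
        forall k l : 'I_n, ex_partial2 k l (fq tau) x
      & K * derive1 (f^~ x) tau =
        \sum_(k < n) \sum_(l < n) C k l * partial k (partial l (fq tau)) x].
Proof.
move=> f fq K tau x tau0 x_ok.
have C_unit := posdef_unitmx C_posdef.
have M_sym : (invmx C)^T = invmx C by rewrite trmx_inv C_sym.
have n0 : 0 <= n%:R :> R by [].
have q0 : 0 < q by apply: le_lt_trans q_gt; rewrite divr_ge0// addr_ge0.
(* Cleared of its denominator, [q_gt] says exactly that [1 / beta] is positive. The denominator of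
   [mu] is then positive too, being at least [1 / beta] when [q <= 1]. *)
have beta0 : 0 < 2 * q + n%:R * (q - 1).
  by move: q_gt; rewrite ltr_pdivrMr; lra.
have mu0 : 0 < 2 + n%:R * (q - 1).
  by have [q1|q1] := lerP q 1; nra.
have q10 : q - 1 != 0 by rewrite subr_eq0.
set a := mu * (n%:R / 2); set p := (q - 1)^-1.
set c := (q - 1) * qbeta n q * tau `^ (- mu).
set M := invmx C in M_sym *.
set Q := fun y : 'cV[R]_n => (y^T *m M *m y) 0 0.
set A := qnorm q C.
have Q0 y : 0 <= Q y by exact: quadform_invmx_ge0.
have qbetaE : qbeta n q = (2 * q + n%:R * (q - 1))^-1.
  by rewrite /qbeta; congr (_^-1); ring.
have c0 : q < 1 -> c < 0.
  move=> q1; rewrite /c qbetaE pmulr_llt0 ?powR_gt0// pmulr_llt0 ?invr_gt0//.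
  by rewrite subr_lt0.
(* For [q < 1] the coefficient [c] is negative, so the bracket is at least [1] everywhere. *)
have b_neq0 y : q < 1 -> 1 - c * Q y != 0.
  move=> /c0 c_lt0; rewrite gt_eqF//.
  by rewrite subr_gt0 (le_lt_trans _ ltr01)// nmulr_rle0.
have p1 : 1 < q -> q < 2 -> 1 < p.
  by move=> q1 q2; rewrite /p invf_gt1 ?subr_gt0//; lra.
(* The second [x]-derivatives and the [tau]-derivative both differentiate [pospow p]; at a zero of
   the bracket this calls for [1 < p]. *)
have x_ok1 : 1 - c * Q x != 0 \/ 1 < p.
  case: x_ok => [q2|bx0]; last first.
    by left; move: bx0; rewrite qbaseZ ?(gt_eqF (powR_gt0 _ tau0))// /c powRN.
  have [/b_neq0|/p1|q1] := ltgtP q 1; [by left|by right; auto|].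
  by rewrite q1 eqxx in q_neq1.
(* The first [x]-derivatives differentiate [pospow (p + 1)], with [1 < p + 1] once [q > 1]; hence
   they exist at every [y] and can be differentiated again. *)
have y_ok y : 1 - c * Q y != 0 \/ 1 < p + 1.
  have [/b_neq0|q1|q1] := ltgtP q 1; first by left.
    by right; rewrite ltrDr /p invr_gt0 subr_gt0.
  by rewrite q1 eqxx in q_neq1.
set B := A `^ q * tau `^ (- a * q).
have fqE : fq tau = fun y => B * pospow (p + 1) (1 - c * Q y).
  by apply/funext => y; rewrite /fq /f qdensity_powR ?(gt_eqF q0).
have D1 l y : is_derive y (delta_mx l 0) (fq tau)
    (B * ((p + 1) * pospow p (1 - c * Q y) * (- (2 * c) * (M *m y) l 0))).
  have := is_derive_pospow_quadform l M_sym (y_ok y).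
  by rewrite fqE addrK => /(is_deriveZ B).
have partial1 l : partial l (fq tau) = fun y =>
    B * ((p + 1) * pospow p (1 - c * Q y) * (- (2 * c) * (M *m y) l 0)).
  by apply/funext => y; rewrite /partial; apply: derive_val.
have D2 k l : is_derive x (delta_mx k 0) (partial l (fq tau))
    (B * (p + 1) * (4 * c ^+ 2 * p * pospow (p - 1) (1 - c * Q x))
       * (M *m x) k 0 * (M *m x) l 0
     + B * (p + 1) * (- (2 * c) * pospow p (1 - c * Q x)) * M l k).
  (* The product rule yields the rank-one term and the [C^-1] term expected by
     [sum_mul_rank1_invmx]. *)
  have -> : partial l (fq tau) = (B * (p + 1) * - (2 * c)) \*:
      ((fun y => pospow p (1 - c * Q y)) * (fun y => (M *m y) l 0)).
    apply/funext => y; rewrite partial1 /= [RHS]mulrA.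
    by ring.
  have D := is_derive_pospow_quadform k M_sym x_ok1.
  have DM := is_derive_mulmx M x (delta_mx k 0) l.
  apply: is_derive_eq
    (is_deriveZ (B * (p + 1) * (- (2 * c))) (is_deriveM D DM)) _.
  have -> : (M *m (delta_mx k 0 : 'cV_n)) l 0 = M l k by rewrite -colE mxE.
  by rewrite -/(Q x) /GRing.scale /=; ring.
have Dtau := is_derive_qdensity_tau tau0 q_neq1 C_unit x_ok1.
split.
- exact: ex_derive.
- move=> k l; split; last exact: ex_derive.
  by apply: (@filterE _ (nbhs x)) => y; apply: ex_derive.
- rewrite derive1E (derive_val (is_derive := Dtau)).
  under eq_bigr => k _ do under eq_bigr => l _ do
    rewrite [partial k _ x](derive_val (is_derive := D2 k l)).
  rewrite sum_mul_rank1_invmx// -/(Q x).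
  have EA : A `^ (q - 1) * A = A `^ q.
    have [->|A0] := eqVneq A 0; first by rewrite mulr0 powR0// gt_eqF.
    rewrite -[A in _ * A]powRr1 ?qnorm_ge0// -powRD ?subrK//.
    by rewrite A0 implybT.
  (* The value of [mu] enters here: [- a q - mu = - a - 1] amounts to [mu (2 + n (q - 1)) = 2]. *)
  have Etau : tau `^ (- a * q) * tau `^ (- mu) = tau `^ (- a) / tau.
    have pow_tauD r s : tau `^ (r + s) = tau `^ r * tau `^ s.
      by rewrite powRD// (gt_eqF tau0) implybT.
    rewrite -(powR_inv1 (ltW tau0)) -!pow_tauD; congr (_ `^ _).
    by rewrite /a mu_def; field; rewrite gt_eqF.
  (* Since [p + 1 = q / (q - 1)], both sides equal [4 q beta]. *)
  have Ecst : (2 * q * (2 + n%:R * (q - 1)) / (2 * q + n%:R * (q - 1))) * mu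
      = 4 * (p + 1) * ((q - 1) * qbeta n q).
    by rewrite qbetaE mu_def /p; field; rewrite q10 (gt_eqF mu0) (gt_eqF beta0).
  rewrite -/p -/c -/A -/a /K /B.
  set P0 := pospow p _; set P1 := pospow (p - 1) _.
  (* As [a = mu n / 2], a factor [mu] comes out of the [tau]-derivative and leaves the bracket of
     the contracted Hessian. *)
  transitivity (A `^ (q - 1) * A * (tau `^ (- a) / tau) *
    (2 * q * (2 + n%:R * (q - 1)) / (2 * q + n%:R * (q - 1)) * mu) *
    (p * P1 * c * Q x - n%:R / 2 * P0)).
    rewrite /a; ring.
  rewrite EA -Etau Ecst.
  transitivity (A `^ q * tau `^ (- a * q) * (p + 1) * 4 *
    ((q - 1) * qbeta n q * tau `^ (- mu)) * (p * P1 * c * Q x - n%:R / 2 * P0)).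
    ring.
  by rewrite -/c; field.
Qed.
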